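(* $\mathrm{ex}'(n,\{\text{taco},\text{swords}\})\in O(n)$.
   Context: Let $P$ be a set of $n$ points in convex position in the plane (the vertices of a convex $n$-gon); a triangle on $P$ is a 3-element subset of $P$. For two distinct triangles $t_1,t_2$ on $P$, label each point of $t_1\cup t_2$ by the triangle(s) containing it and read the points in their cyclic order around the polygon. The pair forms exactly one of eight configurations. (i) If $t_1,t_2$ share two vertices $u,v$: ''taco'' if their third vertices lie on the same side of the line $uv$, ''mariposa'' if on opposite sides. (ii) If they share exactly one vertex $v$: read the remaining four vertices in cyclic order starting just after $v$; ''bat'' if the pattern is $t_1t_1t_2t_2$ or $t_2t_2t_1t_1$, ''nested'' if it is $t_1t_2t_2t_1$ or $t_2t_1t_1t_2$, ''crossing'' if it is $t_1t_2t_1t_2$ or $t_2t_1t_2t_1$. (iii) If they share no vertex, the cyclic sequence of the six labels is, up to rotation, reflection and exchanging the roles of $t_1,t_2$, one of: ''ears'' $AAABBB$, ''swords'' $AABABB$, ''david'' $ABABAB$. Top/bottom variant: partition the vertices of the convex $n$-gon by a horizontal line into a top half of $\lceil n/2\rceil$ vertices and a bottom half of $\lfloor n/2\rfloor$ vertices (each half consisting of consecutive vertices along the polygon). For a set $X$ of configurations, $\mathrm{ex}'(n,X)$ is the maximum size of a family of triangles on $P$, each having exactly two vertices in the top half and one vertex in the bottom half, in which no two triangles form a configuration belonging to $X$. *)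

(* Defs.v *)
From mathcomp Require Import all_boot all_order all_algebra.
From mathcomp Require Import reals.

Set Implicit Arguments.
Unset Strict Implicit.
Unset Printing Implicit Defensive.

Import Order.TTheory GRing.Theory Num.Theory.

(* Twice the signed area of the triangle a b c: positive iff a, b, c is a left
   turn, and its sign tells on which side of the line ab the point c lies. *)
Definition orient (R : realType) (a b c : R * R) : R :=
  ((b.1 - a.1) * (c.2 - a.2) - (b.2 - a.2) * (c.1 - a.1))%R.

(* P 0, ..., P (n - 1) are the vertices of a convex n-gon listed in
   counterclockwise order, so the order of the indices, read cyclically, is the
   cyclic order around the polygon. Injectivity only matters for n = 2. *)
Definition convex_polygon (R : realType) (n : nat) (P : 'I_n -> R * R) : Prop :=
  injective P /\
  forall i j k : 'I_n, i < j -> j < k -> (0 < orient (P i) (P j) (P k))%R.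

(* From here on a vertex is named by its index and a triangle is a 3-element
   set of indices. *)

Inductive config : Type :=
  taco | mariposa | bat | nested | crossing | ears | swords | david.

Section Configurations.

Variables (R : realType) (n : nat) (P : 'I_n -> R * R).
Implicit Types (t : {set 'I_n}) (u v : 'I_n) (w pat : seq bool).

Definition third_same_side t1 t2 : bool :=
  [exists u, exists v, exists a, exists b,
    [&& u != v, t1 :&: t2 == [set u; v],
        t1 :\: t2 == [set a], t2 :\: t1 == [set b]
      & (0 < orient (P u) (P v) (P a) * orient (P u) (P v) (P b))%R]].

Definition third_opposite_sides t1 t2 : bool :=
  [exists u, exists v, exists a, exists b,
    [&& u != v, t1 :&: t2 == [set u; v],
        t1 :\: t2 == [set a], t2 :\: t1 == [set b]
      & (orient (P u) (P v) (P a) * orient (P u) (P v) (P b) < 0)%R]].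

(* Labels of the points of t1 and t2 met along the list s: true for a point of
   t1, false for a point of t2. Only used on lists s without common points. *)
Definition labels (s : seq 'I_n) t1 t2 : seq bool :=
  [seq x \in t1 | x <- s & x \in t1 :|: t2].

(* All vertices other than v, in cyclic order starting just after v. *)
Definition after v : seq 'I_n := [seq x <- rot v.+1 (enum 'I_n) | x != v].

(* t1 and t2 share exactly one vertex v, and the word of labels read after v is
   pat up to exchanging t1 and t2. *)
Definition one_common pat t1 t2 : bool :=
  [exists v, (t1 :&: t2 == [set v]) &&
    (labels (after v) t1 t2 \in [:: pat; map negb pat])].

(* t1 and t2 are disjoint, and their cyclic word of labels is pat up to
   rotation, reflection and exchange of t1 and t2. *)
Definition no_common pat t1 t2 : bool :=
  (t1 :&: t2 == set0) &&
  [exists k : 'I_6, rot k (labels (enum 'I_n) t1 t2) \in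
    [:: pat; rev pat; map negb pat; map negb (rev pat)]].

Let A := true.
Let B := false.

Definition forms t1 t2 (c : config) : bool :=
  match c with
  | taco => third_same_side t1 t2
  | mariposa => third_opposite_sides t1 t2
  | bat => one_common [:: A; A; B; B] t1 t2
  | nested => one_common [:: A; B; B; A] t1 t2
  | crossing => one_common [:: A; B; A; B] t1 t2
  | ears => no_common [:: A; A; A; B; B; B] t1 t2
  | swords => no_common [:: A; A; B; A; B; B] t1 t2
  | david => no_common [:: A; B; A; B; A; B] t1 t2
  end.

Definition avoids (X : seq config) (F : {set {set 'I_n}}) : bool :=
  [forall t1 in F, forall t2 in F, (t1 != t2) ==> ~~ has (forms t1 t2) X].

End Configurations.

Section TopBottom.

Variables (R : realType) (n : nat) (P : 'I_n -> R * R) (h : R).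

Definition top : {set 'I_n} := [set i | (h < (P i).2)%R].
Definition bottom : {set 'I_n} := [set i | ((P i).2 < h)%R].

(* The two cardinals add up to n, so no vertex lies on the line y = h; by
   convexity each half consists of consecutive vertices. *)
Definition halving_line : Prop := #|top| = uphalf n /\ #|bottom| = n./2.

Definition top2_bottom1 (t : {set 'I_n}) : bool :=
  [&& #|t| == 3, #|t :&: top| == 2 & #|t :&: bottom| == 1].

Definition ex' (X : seq config) : nat :=
  \max_(F : {set {set 'I_n}} | [forall t in F, top2_bottom1 t] && avoids P X F)
    #|F|.

End TopBottom.

(* Main.v *)
Require Import Defs.
From mathcomp Require Import all_boot all_order all_algebra.
From mathcomp Require Import reals.
From mathcomp Require Import zify ring lra.

Set Implicit Arguments.
Unset Strict Implicit.
Unset Printing Implicit Defensive.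

Import Order.TTheory GRing.Theory Num.Theory.

(** Cut the polygon at a bottom vertex; the top vertices become linearly
    ordered, and a triangle is a triple (a, b; c) with a < b on top and c at the
    bottom. Avoiding tacos, a triple is determined by (a, b), and, among the
    triples with left end a, by c. Two disjoint triples whose top edges are
    nested form swords. If (a, b2; c2) and (a, b3; c3) are triples with
    b < b2 < b3, and (a1, b; c1) one with a < a1, then the edge (a1, b) is nested
    in both others, so c2 = c1 = c3: a taco. Hence each triple (a, b; c) either
    has one of the two largest right ends b for its a, or the largest left end
    for its b, and there are at most 3n triples. *)

(** * Counting edges between linearly ordered ends *)

Lemma card_edges_no_inner_fan (T I : finType) (F : {set T}) (l r : T -> I)
    (key : I -> nat) :
  injective key ->
  {in F &, forall t t', l t = l t' -> r t = r t' -> t = t'} ->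
  (forall t t1 t2 t3, t \in F -> t1 \in F -> t2 \in F -> t3 \in F ->
     l t1 = l t -> l t2 = l t -> r t3 = r t -> key (l t) < key (l t3) ->
     key (r t) < key (r t1) -> key (r t1) < key (r t2) -> False) ->
  #|F| <= 3 * #|I|.
Proof.
move=> keyI lrI noF.
pose above t := [set t' in F | (l t' == l t) && (key (r t) < key (r t'))].
pose inner t := [set t' in F | (r t' == r t) && (key (l t) < key (l t'))].
(* [F1] holds the edges with the largest left end for their right end; [F2] and [F3] hold those with
   the largest and second largest right end for their left end. So [r] is injective on [F1], and [l]
   on [F2] and on [F3]. *)
pose F1 := [set t in F | inner t == set0].
pose F2 := [set t in F | above t == set0].
pose F3 := [set t in F | (above t != set0) &&
                [forall t' in above t, above t' == set0]].
have cardF (f : T -> I) (A : {set T}) : {in A &, injective f} -> #|A| <= #|I|.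
  by move=> /card_in_imset <-; apply: max_card.
have c1 : #|F1| <= #|I|.
  apply: (cardF r) => t t'; rewrite !inE => /andP[tF /eqP t0] /andP[t'F /eqP t'0] e.
  apply: lrI => //; apply: keyI.
  have := in_set0 t'; rewrite -t0 !inE t'F e eqxx /= => /negbT h1.
  have := in_set0 t; rewrite -t'0 !inE tF e eqxx /= => /negbT h2.
  lia.
have c2 : #|F2| <= #|I|.
  apply: (cardF l) => t t'; rewrite !inE => /andP[tF /eqP t0] /andP[t'F /eqP t'0] e.
  apply: lrI => //; apply: keyI.
  have := in_set0 t'; rewrite -t0 !inE t'F e eqxx /= => /negbT h1.
  have := in_set0 t; rewrite -t'0 !inE tF e eqxx /= => /negbT h2.
  lia.
have c3 : #|F3| <= #|I|.
  apply: (cardF l) => t t'; rewrite !inE.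
  move=> /and3P[tF n0 /forall_inP t0] /and3P[t'F n'0 /forall_inP t'0] e.
  apply: lrI => //; apply: keyI; apply/eqP; rewrite eqn_leq.
  apply/andP; split; rewrite leqNgt; apply/negP => lt.
    by move: n0; rewrite t'0 // !inE tF e eqxx.
  by move: n'0; rewrite t0 // !inE t'F e eqxx.
suff sub : F \subset F1 :|: F2 :|: F3.
  have := subset_leq_card sub; have := (leq_card_setU (F1 :|: F2) F3).1.
  have := (leq_card_setU F1 F2).1; lia.
(* An edge [t] outside the three classes has some [t3] in [inner t], some [t1] in [above t] and some
   [t2] in [above t1]: the excluded fan. *)
apply/subsetP => t tF; rewrite !inE tF /=.
case: (set_0Vmem (inner t)) => [->|[t3]]; first by rewrite eqxx.
rewrite inE => /and3P[t3F /eqP r3 l3].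
case: (boolP (above t == set0)) => [|an0]; first by rewrite orbT.
rewrite /= orbF; apply/orP; right; apply/forall_inP => t1.
rewrite inE => /and3P[t1F /eqP l1 r1].
case: (set_0Vmem (above t1)) => [->|[t2]]; first by rewrite eqxx.
rewrite inE => /and3P[t2F /eqP l2 r2].
by case: (noF t t1 t2 t3) => //; rewrite l2.
Qed.

(** * Convexity and the horizontal line *)

Section Orientation.

Variables (R : realType) (n : nat) (P : 'I_n -> R * R) (h : R).
Hypothesis convP : convex_polygon P.
Local Open Scope ring_scope.

(* The affine dependence of four points, with the areas of the triangles as
   weights: it expresses that the diagonals of a convex quadrangle cross. *)
Lemma orient_dependence (a b c d : R * R) :
  orient b c d * a.2 + orient a b d * c.2
  = orient a c d * b.2 + orient a b c * d.2.
Proof. rewrite /orient; ring. Qed.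

(** Either diagonal splits the quadrangle into two triangles with the same total area. *)
Lemma orient_sum (a b c d : R * R) :
  orient b c d + orient a b d = orient a c d + orient a b c.
Proof. rewrite /orient; ring. Qed.

Lemma orientC (a b c : R * R) : orient a c b = - orient a b c.
Proof. rewrite /orient; ring. Qed.

Lemma orient_rot (a b c : R * R) : orient b c a = orient a b c.
Proof. rewrite /orient; ring. Qed.

(** In the affine dependence all weights are positive and, by [orient_sum], both sides have the same
    total weight. Divided by it, one side is a mean of heights below [h], the other a mean of
    heights above [h]. *)
Lemma bottom_top_no_alternation (i j k l : 'I_n) :
  (i < j)%N -> (j < k)%N -> (k < l)%N ->
  i \in bottom P h -> j \in top P h -> k \in bottom P h -> l \in top P h -> False.
Proof.
move=> ij jk kl; rewrite !inE => hi hj hk hl.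
have [_ cv] := convP.
have ik := ltn_trans ij jk; have jl := ltn_trans jk kl.
have := orient_dependence (P i) (P j) (P k) (P l).
have := orient_sum (P i) (P j) (P k) (P l).
have := cv _ _ _ jk kl; have := cv _ _ _ ij jl.
have := cv _ _ _ ik kl; have := cv _ _ _ ij jk.
nra.
Qed.

Lemma top_bottom_no_alternation (i j k l : 'I_n) :
  (i < j)%N -> (j < k)%N -> (k < l)%N ->
  i \in top P h -> j \in bottom P h -> k \in top P h -> l \in bottom P h -> False.
Proof.
move=> ij jk kl; rewrite !inE => hi hj hk hl.
have [_ cv] := convP.
have ik := ltn_trans ij jk; have jl := ltn_trans jk kl.
have := orient_dependence (P i) (P j) (P k) (P l).
have := orient_sum (P i) (P j) (P k) (P l).
have := cv _ _ _ jk kl; have := cv _ _ _ ij jl.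
have := cv _ _ _ ik kl; have := cv _ _ _ ij jk.
nra.
Qed.

End Orientation.

(** * Cutting the cyclic order open *)

(* Increases from z to z + n - 1 along the cyclic order started at z. *)
Definition cut_key (n : nat) (z x : 'I_n) : nat := if x < z then x + n else x.

Lemma cut_key_inj (n : nat) (z : 'I_n) : injective (cut_key z).
Proof.
move=> x y; rewrite /cut_key => e; apply: val_inj => /=.
have := ltn_ord x; have := ltn_ord y; move: e; do 2!case: ifP; lia.
Qed.

(** Through [cut_key z] the rotated enumeration becomes [iota z n]: adding [n] to the wrapped part
    makes it continue the first part. *)
Lemma sorted_cut_key (n : nat) (z : 'I_n) :
  sorted (relpre (cut_key z) ltn) (rot z (enum 'I_n)).
Proof.
have cut_iota (m : nat) : m <= n ->
    map (fun x => if x < m then x + n else x) (rot m (iota 0 n)) = iota m n.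
  move=> mn; rewrite /rot drop_iota take_iota map_cat add0n (minn_idPl mn).
  transitivity (iota m (n - m) ++ iota (m + (n - m)) m); last first.
    by rewrite -iotaD subnK.
  rewrite subnKC //; congr (_ ++ _).
    rewrite -[RHS]map_id; apply/eq_in_map => x; rewrite mem_iota.
    by case: ifP => //; lia.
  rewrite -[in RHS](addn0 n) iotaDl; apply/eq_in_map => x; rewrite mem_iota.
  by case: ifP => //; lia.
rewrite -sorted_map.
suff -> : map (cut_key z) (rot z (enum 'I_n)) = iota z n by apply: iota_ltn_sorted.
by rewrite -(cut_iota z (ltnW (ltn_ord z))) -val_enum_ord -map_rot -map_comp.
Qed.

(** A strictly sorted list is determined by its members, so words of labels can be read off any list
    of the points sorted by key. *)
Lemma filter_rot_eq (n : nat) (z : 'I_n) (p : pred 'I_n) (s : seq 'I_n) :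
  sorted (relpre (cut_key z) ltn) s -> s =i p ->
  [seq x <- rot z (enum 'I_n) | p x] = s.
Proof.
have tr : transitive (relpre (cut_key z) ltn).
  by move=> y x w /=; apply: ltn_trans.
move=> ss sp; apply: (irr_sorted_eq tr) => //.
- by move=> x /=; rewrite ltnn.
- by apply: sorted_filter => //; apply: sorted_cut_key.
by move=> x; rewrite mem_filter mem_rot mem_enum sp andbT.
Qed.

Lemma labels_rot (n : nat) (m : nat) (t1 t2 : {set 'I_n}) :
  exists2 k, k <= size (labels (rot m (enum 'I_n)) t1 t2) &
    labels (enum 'I_n) t1 t2 = rot k (labels (rot m (enum 'I_n)) t1 t2).
Proof.
(* The labels of the dropped part come first in the rotated list; rotating past them restores the
   original order. *)
exists (size (labels (drop m (enum 'I_n)) t1 t2)).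
  by rewrite /labels /rot filter_cat map_cat size_cat leq_addr.
rewrite /labels /rot filter_cat map_cat -/(rot _ _) rot_size_cat -map_cat.
by rewrite -filter_cat cat_take_drop.
Qed.

(** Since [no_common] allows any rotation of the word, the reading may start at any vertex. *)
Lemma no_common_rot (n m : nat) (pat w : seq bool) (t1 t2 : {set 'I_n}) :
  labels (rot m (enum 'I_n)) t1 t2 = w -> size w = 6 -> t1 :&: t2 = set0 ->
  (exists k : 'I_6, rot k w \in
    [:: pat; rev pat; map negb pat; map negb (rev pat)]) ->
  no_common pat t1 t2.
Proof.
move=> lw sw t120 [j jw]; rewrite /no_common t120 eqxx /=.
have [k] := labels_rot m t1 t2; rewrite lw sw => k6 ->.
apply/existsP.
(* Rotating by [6 - k] undoes the rotation by [k]; then [j] reaches the pattern. *)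
have kj : (j + (6 - k)) %% 6 < 6 by rewrite ltn_mod.
exists (Ordinal kj); rewrite /=.
suff -> : rot ((j + (6 - k)) %% 6) (rot k w) = rot j w by [].
case: j jw kj => j jlt /= _ _.
case: w sw {lw} => [|? [|? [|? [|? [|? [|? [|? ?]]]]]]] //= _.
by case: k k6 => [|[|[|[|[|[|[|k]]]]]]] // _; case: j jlt => [|[|[|[|[|[|j]]]]]].
Qed.

(** * Orientation, tacos and swords in the cut order *)

Section CutAtBottom.

Variables (R : realType) (n : nat) (P : 'I_n -> R * R) (h : R) (z : 'I_n).
Hypothesis convP : convex_polygon P.
Hypothesis zbot : z \in bottom P h.
Implicit Types a b c : 'I_n.

Let key := cut_key z.

Lemma top_neq_bottom a c : a \in top P h -> c \in bottom P h -> a != c.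
Proof.
by rewrite !inE => ha hc; apply/eqP => e; move: ha hc; rewrite e; case: ltgtP.
Qed.

(** Otherwise [z, a, c, b] would alternate between bottom and top in cyclic order, or [c] would be
    [z], whose key is the smallest. *)
Lemma bottom_outside a b c :
  a \in top P h -> b \in top P h -> c \in bottom P h ->
  key a < key b -> key c < key a \/ key b < key c.
Proof.
move=> ta tb bc ab.
have ac := top_neq_bottom ta bc; have bc' := top_neq_bottom tb bc.
have az := top_neq_bottom ta zbot; have bz := top_neq_bottom tb zbot.
have nalt1 := bottom_top_no_alternation convP.
have nalt2 := top_bottom_no_alternation convP.
case: (ltngtP (key c) (key a)) => [|h1|/cut_key_inj e]; first by left.
  case: (ltngtP (key b) (key c)) => [|h2|/cut_key_inj e]; first by right.
    have hz : (c : nat) != z -> False.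
      move=> cz; move: ab h1 h2; rewrite /key /cut_key.
      have := ltn_ord a; have := ltn_ord b; have := ltn_ord c; have := ltn_ord z.
      rewrite -!val_eqE /= in ac bc' az bz *.
      (* The place where the indices wrap around decides which of the four rotations of [z, a, c, b]
         has increasing indices. *)
      case: (ltnP a z) => ?; case: (ltnP b z) => ?; case: (ltnP c z) => ? *;
        first [lia|by apply: (nalt2 h a c b z) => //; lia
                 |by apply: (nalt1 h c b z a) => //; lia
                 |by apply: (nalt2 h b z a c) => //; lia
                 |by apply: (nalt1 h z a c b) => //; lia].
    case: (eqVneq (c : nat) z) => [cz|/hz //].
    by move: h1; rewrite /key /cut_key cz ltnn; case: ifP; have := ltn_ord z; lia.
  by rewrite e eqxx in bc'.
by rewrite e eqxx in ac.
Qed.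

(** By [bottom_outside], [a, b, c] is a rotation of a list with increasing indices, and [orient] is
    invariant under rotation. *)
Lemma orient_top_top_bottom a b c :
  a \in top P h -> b \in top P h -> c \in bottom P h ->
  key a < key b -> (0 < orient (P a) (P b) (P c))%R.
Proof.
move=> ta tb bc ab; have [_ cv] := convP.
have [ca|cb] := bottom_outside ta tb bc ab;
  move: ab; [move: ca|move: cb]; rewrite /key /cut_key;
  have := ltn_ord a; have := ltn_ord b; have := ltn_ord c;
  do 3!case: ifP; move=> *; try lia.
all: first [by apply: cv; lia | by rewrite -orient_rot; apply: cv; lia |
            by rewrite -2!orient_rot; apply: cv; lia].
Qed.

Lemma taco_of_same_side (u v a b : 'I_n) :
  u != v -> a != b -> a != u -> a != v -> b != u -> b != v ->
  (0 < orient (P u) (P v) (P a) * orient (P u) (P v) (P b))%R ->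
  forms P [set u; v; a] [set u; v; b] taco.
Proof.
move=> uv ab au av bu bv o; apply/existsP; exists u; apply/existsP; exists v.
apply/existsP; exists a; apply/existsP; exists b; rewrite uv o andbT /=.
apply/and3P; split; apply/eqP/setP => x; rewrite !inE.
- case: (eqVneq x u) => //= _; case: (eqVneq x v) => //= _.
  by case: (eqVneq x a) => [->|//]; rewrite (negbTE ab).
- case: (eqVneq x u) => [->|_] /=; first by rewrite eq_sym (negbTE au).
  case: (eqVneq x v) => [->|_] /=; first by rewrite eq_sym (negbTE av).
  by case: (eqVneq x a) => [->|]; rewrite ?(negbTE ab) ?andbF.
case: (eqVneq x u) => [->|_] /=; first by rewrite eq_sym (negbTE bu).
case: (eqVneq x v) => [->|_] /=; first by rewrite eq_sym (negbTE bv).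
by case: (eqVneq x b) => [->|]; rewrite ?andbF // eq_sym (negbTE ab).
Qed.

(** The top points read [ABBA]. Both bottom points lie outside the outer edge, so they are
    cyclically adjacent among the six and add [AB] or [BA]; either word is [AABABB] up to rotation
    and reflection. *)
Lemma swords_of_nested a1 a2 b2 b1 c1 c2 :
  a1 \in top P h -> a2 \in top P h -> b2 \in top P h -> b1 \in top P h ->
  c1 \in bottom P h -> c2 \in bottom P h -> c1 != c2 ->
  key a1 < key a2 -> key a2 < key b2 -> key b2 < key b1 ->
  forms P [set a1; b1; c1] [set a2; b2; c2] swords.
Proof.
move=> ta1 ta2 tb2 tb1 bc1 bc2 c12 k1 k2 k3.
have k13 : key a1 < key b1 by lia.
have out1 := bottom_outside ta1 tb1 bc1 k13.
have out2 := bottom_outside ta1 tb1 bc2 k13.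
have kneq x y : key x < key y -> (x == y) = false.
  by move=> lt; apply/eqP => e; rewrite e ltnn in lt.
have kc : key c1 < key c2 \/ key c2 < key c1.
  case: (ltngtP (key c1) (key c2)) => [||/cut_key_inj e]; [by left|by right|].
  by rewrite e eqxx in c12.
have disj : [set a1; b1; c1] :&: [set a2; b2; c2] = set0.
  have k12 := ltn_trans k1 k2; have k23 := ltn_trans k2 k3.
  have tnb x y (xT : x \in top P h) (yB : y \in bottom P h) :=
    negbTE (top_neq_bottom xT yB).
  apply/setP => x; rewrite !inE; apply/negP => /andP[/orP[/orP[]|]] /eqP ->.
  - by rewrite (kneq a1 a2) // (kneq a1 b2) // tnb.
  - by rewrite (tnb b1 c2) // !(eq_sym b1) (kneq a2) // (kneq b2).
  by rewrite (negbTE c12) !(eq_sym c1) !tnb.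
have lab (s : seq 'I_n) : sorted (relpre (cut_key z) ltn) s ->
    perm_eq s [:: a1; b1; c1; a2; b2; c2] ->
    labels (rot z (enum 'I_n)) [set a1; b1; c1] [set a2; b2; c2]
    = [seq x \in [set a1; b1; c1] | x <- s].
  move=> ss ps; rewrite /labels (filter_rot_eq ss) // => x.
  by rewrite (perm_mem ps) -[RHS]/(x \in _ :|: _) !inE -!orbA.
have mem2 x : x \in [set a2; b2; c2] -> (x \in [set a1; b1; c1]) = false.
  by move=> x2; apply/negP => x1; have := in_set0 x; rewrite -disj inE x1 x2.
have m1 : (a1 \in [set a1; b1; c1]) = true by rewrite !inE eqxx.
have m2 : (b1 \in [set a1; b1; c1]) = true by rewrite !inE eqxx orbT.
have m3 : (c1 \in [set a1; b1; c1]) = true by rewrite !inE eqxx orbT.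
have m4 : (a2 \in [set a1; b1; c1]) = false by rewrite mem2 // !inE eqxx.
have m5 : (b2 \in [set a1; b1; c1]) = false by rewrite mem2 // !inE eqxx orbT.
have m6 : (c2 \in [set a1; b1; c1]) = false by rewrite mem2 // !inE eqxx orbT.
pose pats := let pat := [:: true; true; false; true; false; false] in
  [:: pat; rev pat; map negb pat; map negb (rev pat)].
(* The existence of a suitable rotation becomes a boolean that can be computed. *)
have rots w : has (fun k => rot k w \in pats) (iota 0 6) ->
    exists k : 'I_6, rot k w \in pats.
  case/hasP=> k; rewrite mem_iota => /= k6 kw.
  by exists (Ordinal k6).
have concl s w : sorted ltn (map key s) ->
    perm_eq s [:: a1; b1; c1; a2; b2; c2] ->
    [seq x \in [set a1; b1; c1] | x <- s] = w ->
    has (fun k => rot k w \in pats) (iota 0 6) ->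
    forms P [set a1; b1; c1] [set a2; b2; c2] swords.
  rewrite sorted_map => ss ps ew /rots ex.
  apply: (no_common_rot (lab s ss ps)) => //; last by rewrite ew.
  by rewrite size_map (perm_size ps).
(* Each bottom point precedes [a1] or follows [b1]; when both are on the same side, their mutual
   order matters too. This gives six sorted lists. *)
case: out1 => o1; case: out2 => o2; [case: kc => o3| | |case: kc => o3].
- apply: (concl [:: c1; c2; a1; a2; b2; b1]);
    [|by apply/permP => p /=; clear; lia| |].
  + by rewrite /= ?k1 ?k2 ?k3 ?o1 ?o2 ?o3.
  + by rewrite /= m1 m2 m3 m4 m5 m6.
  + by [].
- apply: (concl [:: c2; c1; a1; a2; b2; b1]);
    [|by apply/permP => p /=; clear; lia| |].
  + by rewrite /= ?k1 ?k2 ?k3 ?o1 ?o2 ?o3.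
  + by rewrite /= m1 m2 m3 m4 m5 m6.
  + by [].
- apply: (concl [:: c1; a1; a2; b2; b1; c2]);
    [|by apply/permP => p /=; clear; lia| |].
  + by rewrite /= ?k1 ?k2 ?k3 ?o1 ?o2 ?o3.
  + by rewrite /= m1 m2 m3 m4 m5 m6.
  + by [].
- apply: (concl [:: c2; a1; a2; b2; b1; c1]);
    [|by apply/permP => p /=; clear; lia| |].
  + by rewrite /= ?k1 ?k2 ?k3 ?o1 ?o2 ?o3.
  + by rewrite /= m1 m2 m3 m4 m5 m6.
  + by [].
- apply: (concl [:: a1; a2; b2; b1; c1; c2]);
    [|by apply/permP => p /=; clear; lia| |].
  + by rewrite /= ?k1 ?k2 ?k3 ?o1 ?o2 ?o3.
  + by rewrite /= m1 m2 m3 m4 m5 m6.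
  + by [].
- apply: (concl [:: a1; a2; b2; b1; c2; c1]);
    [|by apply/permP => p /=; clear; lia| |].
  + by rewrite /= ?k1 ?k2 ?k3 ?o1 ?o2 ?o3.
  + by rewrite /= m1 m2 m3 m4 m5 m6.
  + by [].
Qed.

End CutAtBottom.

(** * The linear bound *)

(** Here [key] is arbitrary: plain indices serve first, to find a bottom vertex [z] for the cut, and
    [cut_key z] afterwards. *)
Lemma top2_bottom1_triple (R : realType) (n : nat) (P : 'I_n -> R * R) (h : R)
    (key : 'I_n -> nat) (t : {set 'I_n}) :
  injective key -> top2_bottom1 P h t ->
  exists a b c, [/\ t = [set a; b; c], a \in top P h, b \in top P h,
    c \in bottom P h & key a < key b].
Proof.
move=> keyI /and3P[/eqP t3 /cards2P[x [y [xy tt]]] /cards1P[c tb]].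
have : x \in t :&: top P h by rewrite tt !inE eqxx.
rewrite in_setI => /andP[xt xT].
have : y \in t :&: top P h by rewrite tt !inE eqxx orbT.
rewrite in_setI => /andP[yt yT].
have : c \in t :&: bottom P h by rewrite tb !inE.
rewrite in_setI => /andP[ct cB].
have tE : t = [set x; y; c].
  apply/esym/eqP; rewrite eqEcard; apply/andP; split.
    by apply/subsetP => w; rewrite !inE -orbA => /or3P[] /eqP ->.
  rewrite t3 setUC cardsU1 cards2 xy !inE !(eq_sym c).
  by rewrite (negbTE (top_neq_bottom xT cB)) (negbTE (top_neq_bottom yT cB)).
case: (ltngtP (key x) (key y)) => [lt|lt|/keyI e].
- by exists x, y, c.
- by exists y, x, c; split; rewrite // tE (setUC [set x]).
by rewrite e eqxx in xy.
Qed.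

Lemma card_taco_swords_free (R : realType) (n : nat) (P : 'I_n -> R * R) (h : R)
    (F : {set {set 'I_n}}) :
  convex_polygon P -> {in F, forall t, top2_bottom1 P h t} ->
  avoids P [:: taco; swords] F -> #|F| <= 3 * n.
Proof.
move=> convP FT /forall_inP avF.
case: (set_0Vmem F) => [->|[t0 t0F]]; first by rewrite cards0.
have [z zB] : exists z, z \in bottom P h.
  have [a [b [c [_ _ _ cB _]]]] := top2_bottom1_triple (@ord_inj n) (FT _ t0F).
  by exists c.
pose key := cut_key z.
have free t t' : t \in F -> t' \in F -> t != t' ->
    ~~ forms P t t' taco /\ ~~ forms P t t' swords.
  move=> tF t'F tt'; have /forall_inP/(_ _ t'F)/implyP/(_ tt') := avF _ tF.
  by rewrite [has _ _]/= orbF negb_or => /andP[].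
have [f fP] : exists f : {set 'I_n} -> 'I_n * 'I_n * 'I_n, forall t, t \in F ->
    [/\ t = [set (f t).1.1; (f t).1.2; (f t).2], (f t).1.1 \in top P h,
        (f t).1.2 \in top P h, (f t).2 \in bottom P h
      & key (f t).1.1 < key (f t).1.2].
  apply: (@fin_all_exists _ _ (fun t abc => t \in F ->
    [/\ t = [set abc.1.1; abc.1.2; abc.2], abc.1.1 \in top P h,
        abc.1.2 \in top P h, abc.2 \in bottom P h & key abc.1.1 < key abc.1.2])).
  (* The triple [(z, z, z)] is a dummy value outside [F]. *)
  move=> t; case: (boolP (t \in F)) => [tF|_]; last by exists (z, z, z).
  have [a [b [c H]]] := top2_bottom1_triple (@cut_key_inj _ z) (FT _ tF).
  by exists (a, b, c).
have opos := orient_top_top_bottom convP zB.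
rewrite -[n in 3 * n]card_ord.
apply: (card_edges_no_inner_fan (key := key) (l := fun t => (f t).1.1)
         (r := fun t => (f t).1.2)); first exact: cut_key_inj.
  move=> t t' tF t'F; case: (fP _ tF) (fP _ t'F).
  move: (f t) (f t') => [[a b] c] [[a' b'] c'] /= tE aT bT cB ab [t'E _ _ c'B _] ea eb.
  (* Two triangles on one top edge form a taco: both bottom vertices are on its left. *)
  subst a' b'; apply/eqP/negPn/negP => tt'.
  have [/negP[]] := free _ _ tF t'F tt'; rewrite tE t'E; apply: taco_of_same_side.
  - by apply/eqP => e; rewrite e ltnn in ab.
  - by apply: contraNneq tt'; rewrite tE t'E => ->.
  - by rewrite eq_sym (top_neq_bottom aT cB).
  - by rewrite eq_sym (top_neq_bottom bT cB).
  - by rewrite eq_sym (top_neq_bottom aT c'B).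
  - by rewrite eq_sym (top_neq_bottom bT c'B).
  by rewrite mulr_gt0 ?opos.
move=> t t1 t2 t3 tF t1F t2F t3F.
case: (fP _ tF) (fP _ t1F) (fP _ t2F) (fP _ t3F).
move: (f t) (f t1) (f t2) (f t3).
move=> [[a b] c] [[a1 b1] c1] [[a2 b2] c2] [[a3 b3] c3] /= _ aT bT _ ab.
move=> [t1E _ b1T c1B _] [t2E _ b2T c2B _] [t3E a3T _ c3B a3b] e1 e2 e3 aa3 bb1 b12.
subst a1 a2 b3.
(* As [a < a3 < b < b'] in key order, the top edge of [t3] is nested in that of [t']; distinct
   bottom vertices would give swords. *)
have same_bottom t' b' c' : t' \in F -> t' = [set a; b'; c'] -> b' \in top P h ->
    c' \in bottom P h -> key b < key b' -> c' = c3.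
  move=> t'F t'E b'T c'B bb'; apply/eqP/negPn/negP => cc.
  have sw := swords_of_nested convP zB aT a3T bT b'T c'B c3B cc aa3 a3b bb'.
  have tt : t' != t3.
    apply/eqP => e; have : a \in t3 by rewrite -e t'E !inE eqxx.
    rewrite t3E !inE (negbTE (top_neq_bottom aT c3B)) orbF.
    by case/orP=> /eqP e'; [move: aa3|move: ab]; rewrite -e' ltnn.
  by have [_ /negP[]] := free _ _ t'F t3F tt; rewrite t'E t3E.
have ec1 : c1 = c3 by apply: (same_bottom t1 b1).
have ec2 : c2 = c3 by apply: (same_bottom t2 b2) => //; apply: ltn_trans b12.
subst c1 c2.
have key_neq x y : key x < key y -> x != y.
  by move=> lt; apply/eqP => e; rewrite e ltnn in lt.
have ab1 := ltn_trans ab bb1; have ab2 := ltn_trans ab1 b12.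
have tc : forms P t1 t2 taco.
  (* The shared vertices [a] and [c3] are moved to the front; [b1] and [b2] both lie to the right of
     the line from [a] to [c3]. *)
  rewrite t1E t2E -!setUA ![_ |: [set c3]]setUC !setUA.
  have opos' x : x \in top P h -> key a < key x ->
      (orient (P a) (P c3) (P x) < 0)%R.
    by move=> xT ax; rewrite orientC oppr_lt0 opos.
  apply: taco_of_same_side.
  - exact: top_neq_bottom aT c3B.
  - exact: key_neq.
  - by rewrite eq_sym key_neq.
  - exact: top_neq_bottom b1T c3B.
  - by rewrite eq_sym key_neq.
  - exact: top_neq_bottom b2T c3B.
  by rewrite nmulr_rgt0 opos'.
have tt : t1 != t2.
  apply/eqP => e; have : b1 \in t2 by rewrite -e t1E !inE eqxx orbT.
  rewrite t2E !inE (negbTE (key_neq _ _ b12)) (negbTE (top_neq_bottom b1T c3B)).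
  by rewrite eq_sym (negbTE (key_neq _ _ ab1)).
by have [/negP[]] := free _ _ t1F t2F tt.
Qed.

Theorem theorem12 (R : realType) :
  exists C N : nat, forall n : nat, N <= n ->
  forall (P : 'I_n -> R * R) (h : R),
    convex_polygon P -> halving_line P h ->
    ex' P h [:: taco; swords] <= C * n.
Proof.
(* The constant 3 counts the classes [F1], [F2], [F3]; the bound holds from [n = 0] on. *)
exists 3, 0 => n _ P h convP _; apply/bigmax_leqP => F /andP[/forall_inP FT avF].
exact: card_taco_swords_free convP FT avF.
Qed.
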